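(* (Graded-uniqueness theorem.) Let $\Lambda$ be a row-finite $k$-graph without sources, $R$ a commutative ring with $1$, and $A$ a $\mathbb{Z}^k$-graded ring. If $\pi:\mathrm{KP}_R(\Lambda)\to A$ is a $\mathbb{Z}^k$-graded ring homomorphism such that $\pi(rp_v)\neq0$ for all $r\in R\setminus\{0\}$ and $v\in\Lambda^0$, then $\pi$ is injective.
   Context: Conventions: $\mathbb{N}$ includes $0$, and $k$ is a positive integer. Rings and $R$-algebras are associative but not assumed to have an identity, and homomorphisms are not assumed unit-preserving. A $k$-graph is a countable category $\Lambda$ (with object set $\Lambda^0$, set of morphisms also written $\Lambda$, domain map $s$, codomain map $r$; $\lambda\mu$ is defined when $s(\lambda)=r(\mu)$) together with a functor $d:\Lambda\to\mathbb{N}^k$ (where $\mathbb{N}^k$ is viewed as a category with one object) with the factorization property: if $d(\lambda)=m+n$ there are unique $\mu,\nu\in\Lambda$ with $d(\mu)=m$, $d(\nu)=n$, $\lambda=\mu\nu$. Objects are identified with identity morphisms, so $\Lambda^0=d^{-1}(0)$. Write $\Lambda^n=d^{-1}(n)$ and $v\Lambda^n=\{\lambda\in\Lambda^n:r(\lambda)=v\}$. $\Lambda$ is row-finite if every $v\Lambda^n$ ($v\in\Lambda^0$, $n\in\mathbb{N}^k$) is finite, and has no sources if every $v\Lambda^n$ is nonempty. Let $\Lambda^{\neq0}=\{\lambda\in\Lambda:d(\lambda)\neq0\}$. For each $\lambda\in\Lambda^{\neq0}$ introduce a formal symbol $\lambda^*$ (ghost path), and let $G(\Lambda^{\neq0})=\{\lambda^*:\lambda\in\Lambda^{\neq0}\}$.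 A Kumjian-Pask $\Lambda$-family $(P,S)$ in an $R$-algebra $A$ consists of functions $P:\Lambda^0\to A$ and $S:\Lambda^{\neq0}\cup G(\Lambda^{\neq0})\to A$ such that: (KP1) $\{P_v:v\in\Lambda^0\}$ is a family of mutually orthogonal idempotents; (KP2) for all $\lambda,\mu\in\Lambda^{\neq0}$ with $r(\mu)=s(\lambda)$: $S_\lambda S_\mu=S_{\lambda\mu}$, $S_{\mu^*}S_{\lambda^*}=S_{(\lambda\mu)^*}$, $P_{r(\lambda)}S_\lambda=S_\lambda=S_\lambda P_{s(\lambda)}$, $P_{s(\lambda)}S_{\lambda^*}=S_{\lambda^*}=S_{\lambda^*}P_{r(\lambda)}$; (KP3) for all $\lambda,\mu\in\Lambda^{\neq0}$ with $d(\lambda)=d(\mu)$: $S_{\lambda^*}S_\mu=\delta_{\lambda,\mu}P_{s(\lambda)}$; (KP4) for all $v\in\Lambda^0$ and $n\in\mathbb{N}^k\setminus\{0\}$: $P_v=\sum_{\lambda\in v\Lambda^n}S_\lambda S_{\lambda^*}$. By convention $S_v:=P_v$ and $S_{v^*}:=P_v$ for $v\in\Lambda^0$. The Kumjian-Pask algebra $\mathrm{KP}_R(\Lambda)$ is the $R$-algebra generated by a universal Kumjian-Pask $\Lambda$-family $(p,s)$ (the free $R$-algebra on $\Lambda^0\cup\Lambda^{\neq0}\cup G(\Lambda^{\neq0})$ modulo the relations (KP1)-(KP4)). It is $\mathbb{Z}^k$-graded by $\mathrm{KP}_R(\Lambda)_n=\mathrm{span}_R\{s_\lambda s_{\mu^*}:\lambda,\mu\in\Lambda,\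 d(\lambda)-d(\mu)=n\}$, $n\in\mathbb{Z}^k$. A ring $A$ is $\mathbb{Z}^k$-graded if it has additive subgroups $A_n$ with $A_mA_n\subset A_{m+n}$ and $A=\bigoplus_{n\in\mathbb{Z}^k}A_n$; a homomorphism $\phi:A\to B$ of $\mathbb{Z}^k$-graded rings is graded if $\phi(A_n)\subset B_n$ for all $n$. *)

(* Defs.v *)
From HB Require Import structures.
From mathcomp Require Import all_boot all_order all_algebra.
From mathcomp Require Import boolp classical_sets cardinality.

Set Implicit Arguments.
Unset Strict Implicit.
Unset Printing Implicit Defensive.

Import GRing.Theory.
Local Open Scope ring_scope.
Local Open Scope quotient_scope.

(* Rings and algebras need not have an identity, so they cannot be instances  *)
(* of pzRingType. The product is the semigroup product of monoid.v, written   *)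
(* (x * y)%g; the additive structure is the one of zmodType.                  *)

HB.mixin Record Zmodule_isRng A of GRing.Zmodule A & Semigroup A := {
  rngDl : forall x y z : A, ((x + y)%R * z)%g = (x * z)%g + (y * z)%g;
  rngDr : forall x y z : A, (x * (y + z)%R)%g = (x * y)%g + (x * z)%g
}.

#[short(type="rngType")]
HB.structure Definition Rng :=
  {A of GRing.Zmodule A & Semigroup A & Zmodule_isRng A}.

HB.mixin Record Rng_isRngAlgebra (R : pzRingType) A
    of GRing.Lmodule R A & Rng A := {
  rngZl : forall (a : R) (x y : A), ((a *: x)%R * y)%g = a *: (x * y)%g;
  rngZr : forall (a : R) (x y : A), (x * (a *: y)%R)%g = a *: (x * y)%g
}.

#[short(type="rngAlgType")]
HB.structure Definition RngAlgebra (R : pzRingType) :=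
  {A of GRing.Lmodule R A & Rng A & Rng_isRngAlgebra R A}.

Definition is_rng_hom (A B : rngType) (f : A -> B) : Prop :=
  {morph f : x y / x + y} /\ {morph f : x y / (x * y)%g}.

(* A is the internal direct sum of the A_ n: every element is a finite sum of *)
(* homogeneous elements, and a vanishing finite sum of homogeneous elements   *)
(* of distinct degrees has vanishing terms.                                   *)
Record is_grading (k : nat) (A : rngType) (A_ : 'rV[int]_k -> set A) : Prop :=
  IsGrading {
    grading0 : forall n, A_ n 0;
    gradingB : forall n x y, A_ n x -> A_ n y -> A_ n (x - y);
    gradingM : forall m n x y, A_ m x -> A_ n y -> A_ (m + n) (x * y)%g;
    grading_span : forall x, exists (e : seq 'rV[int]_k) (f : 'rV[int]_k -> A),
      (forall n, A_ n (f n)) /\ x = \sum_(n <- e) f n;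
    grading_direct : forall (e : seq 'rV[int]_k) (f : 'rV[int]_k -> A),
      uniq e -> (forall n, A_ n (f n)) -> \sum_(n <- e) f n = 0 ->
      forall n, n \in e -> f n = 0
  }.

(* kg_comp is total, but it is constrained (and used below) only on pairs     *)
(* (l, m) with kg_s l = kg_r m; its other values are junk.                    *)
Record kgraph (k : nat) := KGraph {
  kg_obj : countType;
  kg_mor : countType;
  kg_s : kg_mor -> kg_obj;
  kg_r : kg_mor -> kg_obj;
  kg_id : kg_obj -> kg_mor;
  kg_comp : kg_mor -> kg_mor -> kg_mor;
  kg_d : kg_mor -> 'rV[nat]_k;
  kg_s_id : forall v, kg_s (kg_id v) = v;
  kg_r_id : forall v, kg_r (kg_id v) = v;
  kg_s_comp : forall l m, kg_s l = kg_r m -> kg_s (kg_comp l m) = kg_s m;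
  kg_r_comp : forall l m, kg_s l = kg_r m -> kg_r (kg_comp l m) = kg_r l;
  kg_idl : forall l, kg_comp (kg_id (kg_r l)) l = l;
  kg_idr : forall l, kg_comp l (kg_id (kg_s l)) = l;
  kg_assoc : forall l m n, kg_s l = kg_r m -> kg_s m = kg_r n ->
    kg_comp l (kg_comp m n) = kg_comp (kg_comp l m) n;
  kg_d_id : forall v, kg_d (kg_id v) = 0;
  kg_d_comp : forall l m, kg_s l = kg_r m ->
    kg_d (kg_comp l m) = kg_d l + kg_d m;
  kg_factor : forall l (m n : 'rV[nat]_k), kg_d l = m + n ->
    exists! p : kg_mor * kg_mor,
      [/\ kg_s p.1 = kg_r p.2, kg_d p.1 = m, kg_d p.2 = n
        & l = kg_comp p.1 p.2]
}.

Definition vpaths k (L : kgraph k) (v : kg_obj L) (n : 'rV[nat]_k) :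
  set (kg_mor L) := [set l | kg_r l = v /\ kg_d l = n]%classic.

Definition row_finite k (L : kgraph k) : Prop :=
  forall (v : kg_obj L) n, finite_set (vpaths v n).

Definition no_sources k (L : kgraph k) : Prop :=
  forall (v : kg_obj L) n, (vpaths v n !=set0)%classic.

Lemma kg_d0_id k (L : kgraph k) (l : kg_mor L) :
  kg_d l = 0 -> l = kg_id (kg_s l).
Proof.
move=> dl0; have [p [_ pU]] := @kg_factor k L l 0 0 (etrans dl0 (esym (addr0 0))).
have := pU (kg_id (kg_r l), l); rewrite /= kg_s_id kg_d_id kg_idl => E1.
have := pU (l, kg_id (kg_s l)); rewrite /= kg_r_id kg_d_id kg_idr => E2.
by have := etrans (esym (E1 (And4 erefl erefl dl0 erefl)))
  (E2 (And4 erefl dl0 erefl erefl)); case.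
Qed.

(* The R-algebra presented by generators X and relations rel: formal          *)
(* expressions modulo the least congruence containing rel and the axioms of   *)
(* an associative, not necessarily unital R-algebra.                          *)

Section Presented.
Variables (R : comPzRingType) (X : Type).

Inductive aterm : Type :=
| AGen of X
| AZero
| AAdd of aterm & aterm
| AOpp of aterm
| AScale of R & aterm
| AMul of aterm & aterm.

Variable rel : aterm -> aterm -> Prop.

Inductive acong : aterm -> aterm -> Prop :=
| acong_rel t u : rel t u -> acong t u
| acong_refl t : acong t t
| acong_sym t u : acong t u -> acong u t
| acong_trans t u v : acong t u -> acong u v -> acong t v
| acong_add t t' u u' : acong t t' -> acong u u' ->
    acong (AAdd t u) (AAdd t' u')
| acong_opp t t' : acong t t' -> acong (AOpp t) (AOpp t')
| acong_scale a t t' : acong t t' -> acong (AScale a t) (AScale a t')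
| acong_mul t t' u u' : acong t t' -> acong u u' ->
    acong (AMul t u) (AMul t' u')
| acong_addA t u v : acong (AAdd t (AAdd u v)) (AAdd (AAdd t u) v)
| acong_addC t u : acong (AAdd t u) (AAdd u t)
| acong_add0 t : acong (AAdd AZero t) t
| acong_addN t : acong (AAdd (AOpp t) t) AZero
| acong_scaleA a b t : acong (AScale a (AScale b t)) (AScale (a * b) t)
| acong_scale1 t : acong (AScale 1 t) t
| acong_scaleDr a t u :
    acong (AScale a (AAdd t u)) (AAdd (AScale a t) (AScale a u))
| acong_scaleDl a b t :
    acong (AScale (a + b) t) (AAdd (AScale a t) (AScale b t))
| acong_mulA t u v : acong (AMul t (AMul u v)) (AMul (AMul t u) v)
| acong_mulDl t u v : acong (AMul (AAdd t u) v) (AAdd (AMul t v) (AMul u v))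
| acong_mulDr t u v : acong (AMul t (AAdd u v)) (AAdd (AMul t u) (AMul t v))
| acong_mulZl a t u : acong (AMul (AScale a t) u) (AScale a (AMul t u))
| acong_mulZr a t u : acong (AMul t (AScale a u)) (AScale a (AMul t u)).

HB.instance Definition _ := gen_eqMixin aterm.
HB.instance Definition _ := gen_choiceMixin aterm.

Definition acongb (t u : aterm) : bool := `[< acong t u >].

Fact acongb_equiv : equiv_class_of acongb.
Proof.
split=> [t|t u|u t v].
- exact/asboolP/acong_refl.
- by apply/asboolP/asboolP; exact: acong_sym.
- by move=> /asboolP tu /asboolP uv; apply/asboolP; exact: acong_trans tu uv.
Qed.

Canonical acong_equiv := EquivRelPack acongb_equiv.

Definition presented := {eq_quot acong_equiv}.
HB.instance Definition _ := Choice.on presented.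
HB.instance Definition _ := EqQuotient.on presented.

Definition pclass (t : aterm) : presented := \pi_presented t.

Lemma pclassP t u : acong t u <-> pclass t = pclass u.
Proof.
by split=> [tu|/eqmodP/asboolP//]; apply/eqmodP/asboolP.
Qed.

Lemma pclassK (x : presented) : pclass (repr x) = x.
Proof. exact: reprK. Qed.

Lemma acong_repr t : acong (repr (pclass t)) t.
Proof. by apply/pclassP; rewrite pclassK. Qed.

Definition padd (x y : presented) := pclass (AAdd (repr x) (repr y)).
Definition popp (x : presented) := pclass (AOpp (repr x)).
Definition pscale (a : R) (x : presented) := pclass (AScale a (repr x)).
Definition pmul (x y : presented) := pclass (AMul (repr x) (repr y)).

Lemma pclass_add t u : padd (pclass t) (pclass u) = pclass (AAdd t u).
Proof. by apply/pclassP/acong_add; exact: acong_repr. Qed.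
Lemma pclass_opp t : popp (pclass t) = pclass (AOpp t).
Proof. by apply/pclassP/acong_opp; exact: acong_repr. Qed.
Lemma pclass_scale a t : pscale a (pclass t) = pclass (AScale a t).
Proof. by apply/pclassP/acong_scale; exact: acong_repr. Qed.
Lemma pclass_mul t u : pmul (pclass t) (pclass u) = pclass (AMul t u).
Proof. by apply/pclassP/acong_mul; exact: acong_repr. Qed.

Let pE := (pclass_add, pclass_opp, pclass_scale, pclass_mul).

Fact paddA : associative padd.
Proof.
move=> x y z; rewrite -(pclassK x) -(pclassK y) -(pclassK z) !pE.
exact/pclassP/acong_addA.
Qed.
Fact paddC : commutative padd.
Proof.
move=> x y; rewrite -(pclassK x) -(pclassK y) !pE; exact/pclassP/acong_addC.
Qed.
Fact padd0 : left_id (pclass AZero) padd.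
Proof. by move=> x; rewrite -(pclassK x) !pE; exact/pclassP/acong_add0. Qed.
Fact paddN : left_inverse (pclass AZero) popp padd.
Proof. by move=> x; rewrite -(pclassK x) !pE; exact/pclassP/acong_addN. Qed.
HB.instance Definition _ :=
  GRing.isZmodule.Build presented paddA paddC padd0 paddN.

Fact pscaleA a b x : pscale a (pscale b x) = pscale (a * b) x.
Proof. by rewrite -(pclassK x) !pE; exact/pclassP/acong_scaleA. Qed.
Fact pscale1 : left_id 1 pscale.
Proof. by move=> x; rewrite -(pclassK x) !pE; exact/pclassP/acong_scale1. Qed.
Fact pscaleDr a x y : pscale a (padd x y) = padd (pscale a x) (pscale a y).
Proof.
rewrite -(pclassK x) -(pclassK y) !pE; exact/pclassP/acong_scaleDr.
Qed.
Fact pscaleDl x a b : pscale (a + b) x = padd (pscale a x) (pscale b x).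
Proof. by rewrite -(pclassK x) !pE; exact/pclassP/acong_scaleDl. Qed.
HB.instance Definition _ := GRing.Zmodule_isLmodule.Build R presented
  pscaleA pscale1 pscaleDr pscaleDl.

Fact pmulA : associative pmul.
Proof.
move=> x y z; rewrite -(pclassK x) -(pclassK y) -(pclassK z) !pE.
exact/pclassP/acong_mulA.
Qed.
HB.instance Definition _ := hasMul.Build presented pmul.
HB.instance Definition _ := Magma_isSemigroup.Build presented pmulA.

Fact pmulDl x y z : pmul (padd x y) z = padd (pmul x z) (pmul y z).
Proof.
rewrite -(pclassK x) -(pclassK y) -(pclassK z) !pE.
exact/pclassP/acong_mulDl.
Qed.
Fact pmulDr x y z : pmul x (padd y z) = padd (pmul x y) (pmul x z).
Proof.
rewrite -(pclassK x) -(pclassK y) -(pclassK z) !pE.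
exact/pclassP/acong_mulDr.
Qed.
HB.instance Definition _ := Zmodule_isRng.Build presented pmulDl pmulDr.

Fact pmulZl a x y : pmul (pscale a x) y = pscale a (pmul x y).
Proof.
by rewrite -(pclassK x) -(pclassK y) !pE; exact/pclassP/acong_mulZl.
Qed.
Fact pmulZr a x y : pmul x (pscale a y) = pscale a (pmul x y).
Proof.
by rewrite -(pclassK x) -(pclassK y) !pE; exact/pclassP/acong_mulZr.
Qed.
HB.instance Definition _ := Rng_isRngAlgebra.Build R presented pmulZl pmulZr.

Lemma pclass0 : pclass AZero = 0. Proof. by []. Qed.
Lemma pclassD t u : pclass (AAdd t u) = pclass t + pclass u.
Proof. by rewrite -pclass_add. Qed.
Lemma pclassN t : pclass (AOpp t) = - pclass t.
Proof. by rewrite -pclass_opp. Qed.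
Lemma pclassZ a t : pclass (AScale a t) = a *: pclass t.
Proof. by rewrite -pclass_scale. Qed.
Lemma pclassM t u : pclass (AMul t u) = (pclass t * pclass u)%g.
Proof. by rewrite -pclass_mul. Qed.

Fixpoint aeval (A : rngAlgType R) (f : X -> A) (t : aterm) : A :=
  match t with
  | AGen x => f x
  | AZero => 0
  | AAdd t u => aeval f t + aeval f u
  | AOpp t => - aeval f t
  | AScale a t => a *: aeval f t
  | AMul t u => (aeval f t * aeval f u)%g
  end.

Definition satisfies (A : rngAlgType R) (f : X -> A) : Prop :=
  forall t u, rel t u -> aeval f t = aeval f u.

Lemma aeval_gen t : aeval (pclass \o AGen) t = pclass t.
Proof.
elim: t => //= [t -> u ->|t ->|a t ->|t -> u ->].
- by rewrite pclassD.
- by rewrite pclassN.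
- by rewrite pclassZ.
- by rewrite pclassM.
Qed.

Lemma presented_satisfies : satisfies (pclass \o AGen).
Proof. by move=> t u tu; rewrite !aeval_gen; apply/pclassP/acong_rel. Qed.

Lemma presented_universal (A : rngAlgType R) (f : X -> A) : satisfies f ->
  exists! g : presented -> A,
    [/\ is_rng_hom g, forall a (x : presented), g (a *: x) = a *: g x
      & forall x, g (pclass (AGen x)) = f x].
Proof.
move=> sat_f.
have evalP t u : acong t u -> aeval f t = aeval f u.
  elim=> //=.
  all: try by [move=> *; congruence].
  - by move=> *; exact: addrA.
  - by move=> *; exact: addrC.
  - by move=> ?; exact: add0r.
  - by move=> ?; exact: addNr.
  - by move=> *; exact: scalerA.
  - by move=> *; exact: scale1r.
  - by move=> *; exact: scalerDr.
  - by move=> *; exact: scalerDl.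
  - by move=> *; exact: mulgA.
  - by move=> *; exact: rngDl.
  - by move=> *; exact: rngDr.
  - by move=> *; exact: rngZl.
  - by move=> *; exact: rngZr.
pose g x := aeval f (repr (x : presented)).
have gE t : g (pclass t) = aeval f t by exact/evalP/acong_repr.
exists g; split=> [|h [[hD hM] hZ hX]].
  split=> [|a x|x]; last by rewrite gE.
  - split=> x y; rewrite -(pclassK x) -(pclassK y).
      by rewrite -pclassD !gE.
    by rewrite -pclassM !gE.
  - by rewrite -(pclassK x) -pclassZ !gE.
have h0 : h 0 = 0 by apply: (addrI (h 0)); rewrite -hD !addr0.
have hN x : h (- x) = - h x.
  by apply: (addrI (h x)); rewrite -hD !subrr.
apply/funext => x; rewrite -(pclassK x) gE.
elim: (repr x) => //= [t IHt u IHu|t IHt|a t IHt|t IHt u IHu].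
- by rewrite pclassD hD IHt IHu.
- by rewrite pclassN hN IHt.
- by rewrite pclassZ hZ IHt.
- by rewrite pclassM hM IHt IHu.
Qed.

End Presented.

Section KumjianPask.
Variables (R : comPzRingType) (k : nat) (L : kgraph k).

Definition npath := {l : kg_mor L | kg_d l != 0}.

Inductive kp_gen : Type :=
| KPVert of kg_obj L
| KPPath of npath
| KPGhost of npath.

Local Notation term := (aterm R kp_gen).

Definition tP (v : kg_obj L) : term := AGen R (KPVert v).

(* S and S^* extended to all paths by S_v := P_v and S_{v^*} := P_v: a path   *)
(* of degree 0 is the identity of its source.                                 *)
Definition tS (l : kg_mor L) : term :=
  if insub l is Some l' then AGen R (KPPath l') else tP (kg_s l).
Definition tG (l : kg_mor L) : term :=
  if insub l is Some l' then AGen R (KPGhost l') else tP (kg_s l).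

Local Notation "x * y" := (AMul x y).

(* In kp4, e enumerates the finite set v L^n.                                 *)
Inductive kp_rel : term -> term -> Prop :=
| kp1_idem v : kp_rel (tP v * tP v) (tP v)
| kp1_orth v w : v != w -> kp_rel (tP v * tP w) (AZero R kp_gen)
| kp2_path l m : kg_d l != 0 -> kg_d m != 0 -> kg_r m = kg_s l ->
    kp_rel (tS l * tS m) (tS (kg_comp l m))
| kp2_ghost l m : kg_d l != 0 -> kg_d m != 0 -> kg_r m = kg_s l ->
    kp_rel (tG m * tG l) (tG (kg_comp l m))
| kp2_rpath l : kg_d l != 0 -> kp_rel (tP (kg_r l) * tS l) (tS l)
| kp2_paths l : kg_d l != 0 -> kp_rel (tS l * tP (kg_s l)) (tS l)
| kp2_sghost l : kg_d l != 0 -> kp_rel (tP (kg_s l) * tG l) (tG l)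
| kp2_ghostr l : kg_d l != 0 -> kp_rel (tG l * tP (kg_r l)) (tG l)
| kp3 l m : kg_d l != 0 -> kg_d m != 0 -> kg_d l = kg_d m ->
    kp_rel (tG l * tS m) (if l == m then tP (kg_s l) else AZero R kp_gen)
| kp4 v (n : 'rV[nat]_k) (e : seq (kg_mor L)) :
    n != 0 -> uniq e -> (forall l, l \in e <-> vpaths v n l) ->
    kp_rel (tP v) (foldr (fun l t => AAdd (tS l * tG l) t) (AZero R kp_gen) e).

Definition KP := presented kp_rel.
HB.instance Definition _ := RngAlgebra.on KP.

Definition kp_p (v : kg_obj L) : KP := pclass kp_rel (tP v).
Definition kp_s (l : kg_mor L) : KP := pclass kp_rel (tS l).
Definition kp_sstar (l : kg_mor L) : KP := pclass kp_rel (tG l).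

Lemma kp_p_sum v (n : 'rV[nat]_k) (e : seq (kg_mor L)) :
  n != 0 -> uniq e -> (forall l, l \in e <-> vpaths v n l) ->
  kp_p v = \sum_(l <- e) (kp_s l * kp_sstar l)%g.
Proof.
move=> n0 Ue eE; rewrite /kp_p; have /pclassP-> := acong_rel (kp4 n0 Ue eE).
elim: e {Ue eE} => [|l e IHe] /=; first by rewrite big_nil.
by rewrite big_cons pclassD pclassM IHe.
Qed.

(* The R-span of the s_l s_{m^*} with d(l) - d(m) = n.                        *)
Definition kp_homog (n : 'rV[int]_k) : set KP :=
  [set x | exists e : seq (R * kg_mor L * kg_mor L),
    (forall c l m, (c, l, m) \in e ->
       map_mx Posz (kg_d l) - map_mx Posz (kg_d m) = n) /\
    x = \sum_(u <- e) u.1.1 *: (kp_s u.1.2 * kp_sstar u.2)%g]%classic.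

End KumjianPask.

Definition is_graded_hom (R : comPzRingType) k (L : kgraph k) (A : rngType)
    (A_ : 'rV[int]_k -> set A) (f : KP R L -> A) : Prop :=
  forall n x, kp_homog n x -> A_ n (f x).

(* Main.v *)
(* Every x in KP is a finite sum of homogeneous elements, so it suffices to   *)
(* treat x of a single degree n. Choose degrees q1, q2 that dominate, by the  *)
(* same t, the degrees of l and of m for each term s_l s_{m^*} of x. If       *)
(* d(a) = q1 and d(b) = q2, then s_{a^*} s_l and s_{m^*} s_b are 0 or of the  *)
(* form s_{a'^*} and s_{b'} with d(a') = d(b') = t, so (KP3) gives            *)
(* s_{a^*} x s_b = c p_{s(a)}. If pi(x) = 0, the hypothesis on pi forces      *)
(* c = 0. All these corners of x then vanish, and x = 0 by (KP4).             *)
Require Import Defs.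
From HB Require Import structures.
From mathcomp Require Import all_boot all_order all_algebra.
From mathcomp Require Import boolp classical_sets cardinality.

Set Implicit Arguments.
Unset Strict Implicit.
Unset Printing Implicit Defensive.

Import GRing.Theory.
Local Open Scope ring_scope.

(** The reduction to one degree takes place in [A]: [kp_sum_homog] writes an element of the kernel
    as a sum of homogeneous elements of distinct degrees. Their images sum to 0, so each image
    vanishes because the grading of [A] is direct. For a single degree, [kp_homog_corner] shows that
    corners [G l * x * S m] are scalar multiples of a vertex idempotent, and [kp_eq0] shows that [x]
    is determined by these corners. Both rest on [kp_spanT]: the products [S l * G m] span. *)

(** * Finite sums in rings without identity *)

Section RngTheory.
Variable A : rngType.
Implicit Types x y : A.

Lemma rng_mul0r x : (0 * x)%g = 0 :> A.
Proof. by apply: (addrI (0 * x)%g); rewrite -rngDl !addr0. Qed.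

Lemma rng_mulr0 x : (x * 0)%g = 0 :> A.
Proof. by apply: (addrI (x * 0)%g); rewrite -rngDr !addr0. Qed.

Lemma rng_suml (I : Type) (e : seq I) (P : pred I) (F : I -> A) x :
  ((\sum_(i <- e | P i) F i)%R * x)%g = \sum_(i <- e | P i) (F i * x)%g.
Proof.
by apply: (big_morph (fun z => (z * x)%g)) => [y z|]; rewrite ?rngDl ?rng_mul0r.
Qed.

Lemma rng_sumr (I : Type) (e : seq I) (P : pred I) (F : I -> A) x :
  (x * (\sum_(i <- e | P i) F i)%R)%g = \sum_(i <- e | P i) (x * F i)%g.
Proof.
by apply: (big_morph (fun z => (x * z)%g)) => [y z|]; rewrite ?rngDr ?rng_mulr0.
Qed.

End RngTheory.

Section RngHom.
Variables (A B : rngType) (f : A -> B).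
Hypothesis f_hom : is_rng_hom f.

Lemma rng_hom0 : f 0 = 0.
Proof. by apply: (addrI (f 0)); rewrite -(proj1 f_hom) !addr0. Qed.

Lemma rng_homN x : f (- x) = - f x.
Proof. by apply: (addrI (f x)); rewrite -(proj1 f_hom) !subrr rng_hom0. Qed.

Lemma rng_hom_sum (I : Type) (e : seq I) (P : pred I) (F : I -> A) :
  f (\sum_(i <- e | P i) F i) = \sum_(i <- e | P i) f (F i).
Proof. exact: (big_morph f (proj1 f_hom) rng_hom0). Qed.

End RngHom.

(** * Finite path sets and degrees *)

Lemma vpaths_enum k (L : kgraph k) (v : kg_obj L) n : row_finite L ->
  exists2 e : seq (kg_mor L), uniq e & forall l, l \in e <-> vpaths v n l.
Proof.
move=> /(_ v n)/finite_seqP[e vnE]; exists (undup e); first exact: undup_uniq.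
by move=> l; rewrite mem_undup vnE.
Qed.

Lemma common_degree_shift k (T : eqType) (d1 d2 : T -> 'rV[nat]_k)
    (n : 'rV[int]_k) (e : seq T) :
  (forall u, u \in e -> map_mx Posz (d1 u) - map_mx Posz (d2 u) = n) ->
  exists q1 q2 : 'rV[nat]_k, forall u, u \in e ->
    exists t, q1 = d1 u + t /\ q2 = d2 u + t.
Proof.
(* The induction must also carry [q1 - q2 = n]. *)
move=> en; suff [q1 [q2 [_ ?]]] : exists q1 q2 : 'rV[nat]_k,
    map_mx Posz q1 - map_mx Posz q2 = n /\ (forall u, u \in e ->
    exists t, q1 = d1 u + t /\ q2 = d2 u + t) by exists q1, q2.
elim: e en => [|u e IHe] en.
  (* The positive and negative parts of [n]; [Negz m] stands for [-(m + 1)]. *)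
  exists (map_mx (fun z : int => if z is Posz m then m else 0%N) n).
  exists (map_mx (fun z : int => if z is Negz m then m.+1 else 0%N) n).
  split=> //; apply/rowP=> i; rewrite !mxE.
  by case: (n 0 i) => m; rewrite ?subr0 // sub0r -NegzE.
have [|q1 [q2 [nE qP]]] := IHe; first
  by move=> v ve; apply: en; rewrite inE ve orbT.
have nu := en u (mem_head u e).
(* Shifting both by [d1 u] keeps the difference [n]. For [u] itself take [t = q1]: then
   [d1 u + q2 = d2 u + q1], since both differences equal [n]. *)
exists (d1 u + q1), (d1 u + q2); split.
  rewrite -nE; apply/rowP=> i; rewrite !mxE !PoszD opprD.
  by rewrite addrACA subrr add0r.
move=> v; rewrite inE => /predU1P[->|/qP[t [-> ->]]].
  exists q1; split=> //; apply/rowP=> i; rewrite !mxE.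
  have /eqP := congr1 (fun w : 'rV_k => w 0 i) (etrans nE (esym nu)).
  by rewrite !mxE subr_eq addrAC eq_sym subr_eq [_ + Posz (d2 _ _ _)]addrC => /eqP[].
by exists (d1 u + t); split; rewrite addrCA.
Qed.

(** * The relations (KP1)-(KP4), extended to paths and degrees equal to 0 *)

Section KumjianPaskTheory.
Variables (R : comPzRingType) (k : nat) (L : kgraph k).
Implicit Types (l m a b : kg_mor L) (v w : kg_obj L).
Local Notation KP := (KP R L).
Local Notation P := (kp_p R).
Local Notation S := (kp_s R).
Local Notation G := (kp_sstar R).

Lemma kp_relE t u : @kp_rel R k L t u ->
  pclass (@kp_rel R k L) t = pclass (@kp_rel R k L) u.
Proof. by move=> tu; apply/pclassP/acong_rel. Qed.

Lemma kg_d0_r l : kg_d l = 0 -> kg_r l = kg_s l.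
Proof. by move=> /kg_d0_id {1}->; rewrite kg_r_id. Qed.

Lemma kp_s_d0 l : kg_d l = 0 -> S l = P (kg_s l).
Proof. by move=> l0; rewrite /kp_s /tS insubF ?l0 ?eqxx. Qed.

Lemma kp_sstar_d0 l : kg_d l = 0 -> G l = P (kg_s l).
Proof. by move=> l0; rewrite /kp_sstar /tG insubF ?l0 ?eqxx. Qed.

Lemma kp_s_id v : S (kg_id v) = P v.
Proof. by rewrite kp_s_d0 ?kg_d_id ?kg_s_id. Qed.

Lemma kp_sstar_id v : G (kg_id v) = P v.
Proof. by rewrite kp_sstar_d0 ?kg_d_id ?kg_s_id. Qed.

Lemma kp_pp v w : (P v * P w)%g = if v == w then P v else 0.
Proof.
rewrite /kp_p -pclassM; case: eqVneq => [<-|vw].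
  exact/kp_relE/kp1_idem.
by rewrite -pclass0; apply/kp_relE/kp1_orth.
Qed.

Lemma kp_ps l : (P (kg_r l) * S l)%g = S l.
Proof.
have [l0|l0] := eqVneq (kg_d l) 0; last first.
  by rewrite -pclassM; apply/kp_relE/kp2_rpath.
by rewrite kp_s_d0 // kg_d0_r // kp_pp eqxx.
Qed.

Lemma kp_sp l : (S l * P (kg_s l))%g = S l.
Proof.
have [l0|l0] := eqVneq (kg_d l) 0; last first.
  by rewrite -pclassM; apply/kp_relE/kp2_paths.
by rewrite kp_s_d0 // kp_pp eqxx.
Qed.

Lemma kp_pg l : (P (kg_s l) * G l)%g = G l.
Proof.
have [l0|l0] := eqVneq (kg_d l) 0; last first.
  by rewrite -pclassM; apply/kp_relE/kp2_sghost.
by rewrite kp_sstar_d0 // kp_pp eqxx.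
Qed.

Lemma kp_gp l : (G l * P (kg_r l))%g = G l.
Proof.
have [l0|l0] := eqVneq (kg_d l) 0; last first.
  by rewrite -pclassM; apply/kp_relE/kp2_ghostr.
by rewrite kp_sstar_d0 // kg_d0_r // kp_pp eqxx.
Qed.

Lemma kp_ss l m : kg_s l = kg_r m -> (S l * S m)%g = S (kg_comp l m).
Proof.
move=> lm; have [l0|l0] := eqVneq (kg_d l) 0.
  by rewrite kp_s_d0 // lm kp_ps (kg_d0_id l0) lm kg_idl.
have [m0|m0] := eqVneq (kg_d m) 0; last first.
  by rewrite -pclassM; apply/kp_relE/kp2_path.
by rewrite (kp_s_d0 m0) -kg_d0_r // -lm kp_sp (kg_d0_id m0) -kg_d0_r //
  -lm kg_idr.
Qed.

Lemma kp_gg l m : kg_s l = kg_r m -> (G m * G l)%g = G (kg_comp l m).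
Proof.
move=> lm; have [l0|l0] := eqVneq (kg_d l) 0.
  by rewrite (kp_sstar_d0 l0) lm kp_gp (kg_d0_id l0) lm kg_idl.
have [m0|m0] := eqVneq (kg_d m) 0; last first.
  by rewrite -pclassM; apply/kp_relE/kp2_ghost.
by rewrite (kp_sstar_d0 m0) -kg_d0_r // -lm kp_pg (kg_d0_id m0) -kg_d0_r //
  -lm kg_idr.
Qed.

Lemma kp_gs l m : kg_d l = kg_d m ->
  (G l * S m)%g = if l == m then P (kg_s l) else 0.
Proof.
move=> lm; have [m0|m0] := eqVneq (kg_d m) 0.
  rewrite kp_sstar_d0 ?lm // kp_s_d0 // kp_pp.
  have [->|/eqP lm_neq] := eqVneq l m; first by rewrite eqxx.
  case: eqVneq => // slm; case: lm_neq; rewrite (kg_d0_id m0) -slm.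
  by apply: kg_d0_id; rewrite lm.
have l0 : kg_d l != 0 by rewrite lm.
rewrite -pclassM (kp_relE (kp3 R l0 m0 lm)).
by case: eqP.
Qed.

Lemma kp_p_vpaths v n (e : seq (kg_mor L)) :
  uniq e -> (forall l, l \in e <-> vpaths v n l) ->
  P v = \sum_(l <- e) (S l * G l)%g.
Proof.
have [->|] := eqVneq n 0; last exact: kp_p_sum.
move=> Ue eE; have e_id : perm_eq e [:: kg_id v].
  apply: uniq_perm => // l; rewrite inE; apply/idP/eqP => [/eE[<- l0]|->].
    by rewrite kg_d0_r // -kg_d0_id.
  by apply/eE; split; [exact: kg_r_id|exact: kg_d_id].
by rewrite (perm_big _ e_id) big_seq1 kp_s_id kp_sstar_id kp_pp eqxx.
Qed.

(** Factor [l] as [b] followed by [m] with [d(b) = d(a)]. Then [G l = G m * G b], and (KP3) decides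
    [G b * S a]. *)
Lemma kp_gs_prefix l a n : kg_d l = kg_d a + n ->
  (G l * S a)%g = 0 \/
  exists m, [/\ kg_d m = n, kg_s m = kg_s l & (G l * S a)%g = G m].
Proof.
move=> /kg_factor[[b m] [[/= bm db dm ->] _]]; rewrite -kp_gg // -mulgA kp_gs //.
case: eqP => _; last by left; rewrite rng_mulr0.
by right; exists m; rewrite kg_s_comp // bm kp_gp.
Qed.

Lemma kp_gs_suffix l a n : kg_d l = kg_d a + n ->
  (G a * S l)%g = 0 \/ exists2 m, kg_d m = n & (G a * S l)%g = S m.
Proof.
move=> /kg_factor[[b m] [[/= bm db dm ->] _]]; rewrite -kp_ss // mulgA kp_gs //.
case: eqVneq => [->|_]; last by left; rewrite rng_mul0r.
by right; exists m => //; rewrite bm kp_ps.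
Qed.

(** * Spanning by the products [S l * G m] *)

Definition kp_span (x : KP) : Prop := exists e : seq (R * kg_mor L * kg_mor L),
  x = \sum_(u <- e) u.1.1 *: (S u.1.2 * G u.2)%g.

Lemma kp_span0 : kp_span 0.
Proof. by exists [::]; rewrite big_nil. Qed.

Lemma kp_spanD x y : kp_span x -> kp_span y -> kp_span (x + y).
Proof. by move=> [e ->] [f ->]; exists (e ++ f); rewrite big_cat. Qed.

Lemma kp_spanZ c x : kp_span x -> kp_span (c *: x).
Proof.
move=> [e ->]; exists [seq (c * u.1.1, u.1.2, u.2) | u <- e].
by rewrite big_map scaler_sumr; apply: eq_bigr => u _; rewrite scalerA.
Qed.

Lemma kp_span_sg l m : kp_span (S l * G m)%g.
Proof. by exists [:: (1, l, m)]; rewrite big_seq1 scale1r. Qed.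

Lemma kp_span_sum (I : Type) (e : seq I) (F : I -> KP) :
  (forall i, kp_span (F i)) -> kp_span (\sum_(i <- e) F i).
Proof. by move=> FP; apply: big_ind => //; [exact: kp_span0|exact: kp_spanD]. Qed.

(** If the paths on either side do not compose, orthogonal vertex idempotents meet and the product
    is 0. *)
Lemma kp_spanSG l m a b : kp_span (S l * (S a * G b) * G m)%g.
Proof.
have [la|/negPf la] := eqVneq (kg_s l) (kg_r a); last first.
  by rewrite -(kp_sp l) -(kp_ps a) -!mulgA (mulgA (P _) (P _)) kp_pp la
    !(rng_mul0r, rng_mulr0); exact: kp_span0.
have [mb|/negPf mb] := eqVneq (kg_r b) (kg_s m); last first.
  by rewrite -(kp_pg m) -(kp_gp b) -!mulgA (mulgA (P _) (P _)) kp_pp mb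
    !(rng_mul0r, rng_mulr0); exact: kp_span0.
rewrite mulgA -(mulgA (_ * _)%g) kp_ss // kp_gg //; exact: kp_span_sg.
Qed.

(* Insert [P (kg_r m) = \sum S l * G l] over the paths [l] of degree          *)
(* [kg_d m + kg_d a] into [G m * S a]: both [m] and [a] are shorter than [l]. *)
Lemma kp_span_gs m a : row_finite L -> kp_span (G m * S a)%g.
Proof.
move=> /vpaths_enum-/(_ (kg_r m) (kg_d m + kg_d a))[e Ue eE].
rewrite -kp_gp (kp_p_vpaths Ue eE) rng_sumr rng_suml big_seq_cond.
apply: big_ind => [||l]; [exact: kp_span0|exact: kp_spanD|].
rewrite andbT => /eE[_ dl]; rewrite mulgA -(mulgA (_ * _)%g).
have [->|[b _ ->]] := kp_gs_suffix dl.
  by rewrite rng_mul0r; exact: kp_span0.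
have [->|[c [_ _ ->]]] := kp_gs_prefix (etrans dl (addrC _ _)).
  by rewrite rng_mulr0; exact: kp_span0.
exact: kp_span_sg.
Qed.

Lemma kp_spanM x y : row_finite L ->
  kp_span x -> kp_span y -> kp_span (x * y)%g.
Proof.
move=> rf [e ->] [f ->]; rewrite rng_suml; apply: kp_span_sum => u.
rewrite rng_sumr; apply: kp_span_sum => w.
rewrite rngZl rngZr; do 2 apply: kp_spanZ.
(* Isolate the inner product of a ghost path and a path, expand it in the span, and absorb the outer
   factors term by term. *)
rewrite mulgA -(mulgA (S _)).
have [g ->] := kp_span_gs u.2 w.1.2 rf.
rewrite rng_sumr rng_suml; apply: kp_span_sum => z.
rewrite rngZr rngZl; apply: kp_spanZ; exact: kp_spanSG.
Qed.

Lemma kp_spanT x : row_finite L -> kp_span x.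
Proof.
move=> rf; rewrite -(pclassK x).
elim: (repr x) => [[v|l|l]||t IHt u IHu|t IHt|c t IHt|t IHt u IHu].
- by rewrite -[pclass _ _]/(P v) -kp_s_id -kp_sp -[P _]kp_sstar_id;
  exact: kp_span_sg.
- have -> : pclass (@kp_rel R k L) (AGen R (KPPath l)) = S (val l).
    by rewrite /kp_s /tS valK.
  by rewrite -kp_sp -kp_sstar_id; exact: kp_span_sg.
- have -> : pclass (@kp_rel R k L) (AGen R (KPGhost l)) = G (val l).
    by rewrite /kp_sstar /tG valK.
  by rewrite -kp_pg -kp_s_id; exact: kp_span_sg.
- exact: kp_span0.
- by rewrite pclassD; exact: kp_spanD.
- by rewrite pclassN -scaleN1r; exact: kp_spanZ.
- by rewrite pclassZ; exact: kp_spanZ.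
- by rewrite pclassM; exact: kp_spanM.
Qed.

(** * Local units, corners and homogeneous components *)

Lemma kp_local_unit x : row_finite L -> exists V : seq (kg_obj L),
  x = (((\sum_(v <- V) P v)%R * x) * (\sum_(v <- V) P v)%R)%g.
Proof.
move=> /(kp_spanT x)[e xE].
(* The ranges of all paths in the expansion of [x]. Without [undup] a repeated vertex would be
   counted twice and the sum would not act as an identity. *)
pose V := undup ([seq kg_r u.1.2 | u <- e] ++ [seq kg_r u.2 | u <- e]).
have UV : uniq V := undup_uniq _.
have VP v : v \in V -> ((\sum_(w <- V) P w)%R * P v)%g = P v.
  move=> vV; rewrite rng_suml (bigD1_seq v) //= kp_pp eqxx big1 ?addr0 // => w.
  by rewrite kp_pp => /negPf->.
have PV v : v \in V -> (P v * (\sum_(w <- V) P w)%R)%g = P v.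
  move=> vV; rewrite rng_sumr (bigD1_seq v) //= kp_pp eqxx big1 ?addr0 // => w.
  by rewrite kp_pp eq_sym => /negPf->.
exists V; move: (\sum_(v <- V) P v) VP PV => U VP PV.
rewrite {1 2}xE rng_sumr rng_suml; apply: eq_big_seq => u ue.
rewrite rngZr rngZl; congr (_ *: _).
have uU : (G u.2 * U)%g = G u.2.
  rewrite -kp_gp -mulgA PV // mem_undup mem_cat; apply/orP; right.
  by apply/mapP; exists u.
have Uu : (U * S u.1.2)%g = S u.1.2.
  rewrite -kp_ps mulgA VP // mem_undup mem_cat; apply/orP; left.
  by apply/mapP; exists u.
by rewrite mulgA Uu -mulgA uU.
Qed.

(** Between local units, [x] is a sum of terms [P v * x * P w]. Expanding [P v] over paths of degree
    [q1] and [P w] over paths of degree [q2] by (KP4) turns these into sums of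
    [S l * (G l * x * S m) * G m]. *)
Lemma kp_eq0 q1 q2 (x : KP) : row_finite L ->
  (forall l m, kg_d l = q1 -> kg_d m = q2 -> (G l * x * S m)%g = 0) -> x = 0.
Proof.
move=> rf x0; have [V ->] := kp_local_unit x rf.
rewrite rng_suml rng_suml big1 // => v _; rewrite rng_sumr big1 // => w _.
have [e Ue eE] := vpaths_enum v q1 rf.
have [f Uf fE] := vpaths_enum w q2 rf.
rewrite (kp_p_vpaths Ue eE) (kp_p_vpaths Uf fE).
rewrite rng_suml rng_suml big_seq big1 // => l /eE[_ dl].
rewrite rng_sumr big_seq big1 // => m /fE[_ dm].
by rewrite mulgA -2!(mulgA (S l)) x0 // rng_mulr0 rng_mul0r.
Qed.

(** The common shift [t] lets (KP3) apply to every term. The shortened path [l'] keeps the source of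
    [l], so all terms are multiples of the same idempotent and add up to one multiple. *)
Lemma kp_homog_corner n (x : KP) : kp_homog n x ->
  exists q1 q2 : 'rV[nat]_k, forall l m, kg_d l = q1 -> kg_d m = q2 ->
    exists c, (G l * x * S m)%g = c *: P (kg_s l).
Proof.
move=> [e [en ->]].
have [|q1 [q2 qP]] := @common_degree_shift k _ (fun u => kg_d u.1.2)
    (fun u : R * kg_mor L * kg_mor L => kg_d u.2) n e.
  by move=> [[c l] m] /en.
exists q1, q2 => l m dl dm; rewrite rng_sumr rng_suml big_seq.
apply: (big_ind (fun z : KP => exists c, z = c *: P (kg_s l)))
  => [|y z [c ->] [d ->]|[[c a] b] /qP[t [/= q1E q2E]]].
- by exists 0; rewrite scale0r.
- by exists (c + d); rewrite scalerDl.
rewrite rngZr rngZl mulgA -(mulgA (_ * _)%g).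
have [->|[l' [dl' <- ->]]] := kp_gs_prefix (etrans dl q1E).
  by exists 0; rewrite rng_mul0r scaler0 scale0r.
have [->|[m' dm' ->]] := kp_gs_suffix (etrans dm q2E).
  by exists 0; rewrite rng_mulr0 scaler0 scale0r.
rewrite kp_gs ?dl' //; case: eqP => _; first by exists c.
by exists 0; rewrite scaler0 scale0r.
Qed.

Lemma kp_sum_homog x : row_finite L ->
  exists (D : seq 'rV[int]_k) (f : 'rV[int]_k -> KP),
    [/\ uniq D, forall n, kp_homog n (f n) & x = \sum_(n <- D) f n].
Proof.
move=> /(kp_spanT x)[e ->].
pose deg (u : R * kg_mor L * kg_mor L) :=
  map_mx Posz (kg_d u.1.2) - map_mx Posz (kg_d u.2).
exists (undup (map deg e)), (fun n =>
  \sum_(u <- e | deg u == n) u.1.1 *: (S u.1.2 * G u.2)%g).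
split=> [|n|]; first exact: undup_uniq.
  exists [seq u <- e | deg u == n]; rewrite big_filter; split=> // c l m.
  by rewrite mem_filter => /andP[/eqP].
(* After the exchange, each [u] contributes exactly once, at the index [deg u]. *)
rewrite (exchange_big_dep xpredT) //=; apply: eq_big_seq => u ue.
rewrite big_mkcond (bigD1_seq (deg u)) ?undup_uniq ?mem_undup ?map_f //= eqxx.
by rewrite big1 ?addr0 // => n; rewrite eq_sym => /negPf->.
Qed.

End KumjianPaskTheory.

Theorem theorem4p1 (k : nat) (k_gt0 : (0 < k)%N) (L : kgraph k)
    (L_rf : row_finite L) (L_ns : no_sources L) (R : comPzRingType)
    (A : rngType) (A_ : 'rV[int]_k -> set A) (A_gr : is_grading A_)
    (pi : KP R L -> A) (pi_hom : is_rng_hom pi) (pi_gr : is_graded_hom A_ pi)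
    (pi_p : forall (r : R) (v : kg_obj L), r != 0 -> pi (r *: kp_p R v) != 0) :
  injective pi.
Proof.
have homog_eq0 n y : kp_homog n y -> pi y = 0 -> y = 0.
  move=> /kp_homog_corner[q1 [q2 yP]] y0; apply: (@kp_eq0 _ _ _ q1 q2) => // l m dl dm.
  have [c cE] := yP l m dl dm; rewrite cE.
  (* A nonzero [c] is impossible: [c *: P (s l)] is the corner [G l * y * S m], which [pi] kills
     along with [y]. *)
  have [->|/(pi_p c (kg_s l))] := eqVneq c 0; first by rewrite scale0r.
  by rewrite -cE !(proj2 pi_hom) y0 rng_mulr0 rng_mul0r eqxx.
move=> x y xy; apply/eqP; rewrite -subr_eq0; apply/eqP.
have : pi (x - y) = 0 by rewrite (proj1 pi_hom) rng_homN // xy subrr.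
have [D [f [UD fH ->]]] := kp_sum_homog (x - y) L_rf.
rewrite rng_hom_sum // => pif0; rewrite big_seq big1 // => n nD.
apply: (homog_eq0 n) => //.
(* The degrees in [D] are distinct and each [pi (f j)] is homogeneous of degree [j], so directness
   in [A] applies. *)
by apply: (grading_direct A_gr (e := D) (f := pi \o f)) => // j; exact: pi_gr.
Qed.
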